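(* Let $n\ge 2$, let $\vec a=\bigl(\binom n1,\binom n2,\dots,\binom nn\bigr)$, let $1\le d\le n-1$, and put $m=n-d$. Let $\mathsf M=\mathsf M(\vec a;d)$ be the extremal matrix of the polytope $\operatorname{RA}(\vec a;0,d)$. Then for indices $1\le i,j\le n$, writing $t=i-d$, $$\mathsf M[i][j]=0\iff 1\le t\le m,\quad 1\le j\le m,\quad\text{and}\quad (j<t\ \text{ or }\ j=t+1),$$ and $\mathsf M[i][j]=1$ otherwise. Consequently the vertices of $\operatorname{RA}(\vec a;0,d)$ are exactly the points $v_i+u_j$ with $\mathsf M[i][j]=1$; these points are pairwise distinct, and $$\#\operatorname{vert}\bigl(\operatorname{RA}(\vec a;0,d)\bigr)=n^2-\frac{(m-1)(m+2)}{2}.$$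
   Context: For a vector $\vec a=(a_1,\dots,a_n)$ of positive integers, let $v_j=(a_1,\dots,a_j,0,\dots,0)\in\mathbb R^n$ for $1\le j\le n$, and let $\angle(\vec a)=\operatorname{conv}\{v_1,\dots,v_n\}$ (the right-angle simplex). Put $N=n+d$. Regard $\mathbb R^n\subseteq\mathbb R^N$ by padding with zeros on the right, and let $\operatorname{shift}^d:\mathbb R^n\to\mathbb R^N$ prepend $d$ zeros. Write $u_j=\operatorname{shift}^d(v_j)$. The right-angle polytope is the Minkowski sum $\operatorname{RA}(\vec a;0,d)=\angle(\vec a)+\operatorname{shift}^d(\angle(\vec a))\subseteq\mathbb R^N$. The extremal matrix $\mathsf M(\vec a;d)$ is the $n\times n$ matrix with entries in $\{0,1\}$, indices running from $1$ to $n$, defined by $\mathsf M(\vec a;d)[i][j]=1$ if and only if $v_i+u_j$ is a vertex (extreme point) of $\operatorname{RA}(\vec a;0,d)$; the row index $i$ belongs to the unshifted summand and the column index $j$ to the shifted one. $\operatorname{vert}(P)$ is the set of vertices of $P$. *)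

(* Defs.v *)
From mathcomp Require Import all_boot all_order all_algebra.
From mathcomp Require Import boolp classical_sets functions cardinality reals.

Set Implicit Arguments.
Unset Strict Implicit.
Unset Printing Implicit Defensive.

Import Order.TTheory GRing.Theory Num.Theory.
Local Open Scope classical_set_scope.
Local Open Scope ring_scope.

Definition conv_family (R : realType) (V : lmodType R) (n : nat)
    (p : 'I_n -> V) : set V :=
  [set x | exists w : 'I_n -> R,
     [/\ forall k, 0 <= w k, \sum_k w k = 1 & x = \sum_k w k *: p k]].

Definition minkowski_sum (V : zmodType) (A B : set V) : set V :=
  [set x + y | x in A & y in B].

Definition vert (R : realType) (V : lmodType R) (P : set V) : set V :=
  [set x | P x /\
     forall (y z : V) (s : R), P y -> P z -> 0 < s < 1 ->
       x = s *: y + (1 - s) *: z -> y = x /\ z = x].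

(* Ordinals of 'I_n are 0-based: a k stands for a_(k+1).  In [ra_v], on the
   contrary, j : nat is the 1-based index of v_j = (a_1, .., a_j, 0, .., 0). *)
Definition ra_v (R : realType) (n : nat) (a : 'I_n -> nat) (j : nat) : 'rV[R]_n :=
  \row_(k < n) (if (k < j)%N then (a k)%:R else 0).

Definition right_angle_simplex (R : realType) (n : nat) (a : 'I_n -> nat) :
    set 'rV[R]_n :=
  conv_family (fun j : 'I_n => ra_v R a j.+1).
Arguments right_angle_simplex R {n} a.

Definition pad (R : realType) (n d : nat) (x : 'rV[R]_n) : 'rV[R]_(n + d) :=
  row_mx x 0.

Definition shift (R : realType) (n d : nat) (x : 'rV[R]_n) : 'rV[R]_(n + d) :=
  castmx (erefl, addnC d n) (row_mx (0 : 'rV[R]_d) x).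

Definition RA (R : realType) (n : nat) (a : 'I_n -> nat) (d : nat) :
    set 'rV[R]_(n + d) :=
  minkowski_sum (@pad R n d @` right_angle_simplex R a)
                (@shift R n d @` right_angle_simplex R a).
Arguments RA R {n} a d.

(* v_i + u_j in R^(n + d), with 1-based i and j *)
Definition ra_point (R : realType) (n : nat) (a : 'I_n -> nat) (d i j : nat) :
    'rV[R]_(n + d) :=
  pad d (ra_v R a i) + shift d (ra_v R a j).

(* The entry at ordinals (i, j) is the one with 1-based indices (i + 1, j + 1);
   the boolean is coerced to 0 or 1 in nat. *)
Definition extremal_matrix (R : realType) (n : nat) (a : 'I_n -> nat) (d : nat) :
    'M[nat]_n :=
  \matrix_(i < n, j < n) nat_of_bool `[< vert (RA R a d) (ra_point R a d i.+1 j.+1) >].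

(* Main.v *)
Require Import Defs.
From HB Require Import structures.
From mathcomp Require Import all_boot all_order all_algebra.
From mathcomp Require Import boolp classical_sets functions cardinality reals.
From mathcomp Require Import zify ring lra.

(* v_i + u_j is a vertex as soon as one linear functional is maximised only at
   v_i among the v's and only at u_j among the u's, and it is not a vertex as
   soon as v_i + u_j = p + q with (p, q) <> (v_i, u_j) in the two summands.

   Write b_k = 'C(n, k + 1), with 0-based indices.  A functional with
   coordinates c_0, c_1, ... takes the values \sum_(k <= i) b_k c_k at v_i and
   \sum_(k <= j) b_k c_(d + k) at u_j, so the two families interact only
   through the coordinates d, ..., n - 1, where the ratio of the weights,
   b_k / b_(d + k), is increasing in k by log-concavity of the binomials.
   - If i < d or n <= d + j, one coordinate is free for one of the families and
     a huge weight there isolates the vertex.  If i = d + j, signs suffice.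
   - If i + 1 < d + j < n, a weight -p at i + 1 and a weight q at d + j, with
     zeros in between, suffice when q / p lies between two consecutive bounds
     that are ordered the right way by log-concavity.
   - If d + j = i + 1, the edges from v_i to v_(i+1) and from u_j to u_(j-1)
     have opposite directions, and moving along both gives another
     decomposition of v_i + u_j.
   - If d + j < i, then u_j can be moved towards u_(i-d), and log-concavity
     says precisely that v_i can be moved the opposite way in its simplex. *)

Set Implicit Arguments.
Unset Strict Implicit.
Unset Printing Implicit Defensive.

Import Order.TTheory GRing.Theory Num.Theory.
Local Open Scope classical_set_scope.
Local Open Scope ring_scope.

(** * Convex hulls of finite families and extreme points of their Minkowski sums *)

Definition convex_in (R : realType) (V : lmodType R) (A : set V) :=
  forall (x y : V) (s : R), A x -> A y -> 0 <= s <= 1 ->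
    A (s *: x + (1 - s) *: y).

Lemma conv_family_mem (R : realType) (V : lmodType R) (n : nat)
  (p : 'I_n -> V) (k : 'I_n) : conv_family p (p k).
Proof.
exists (fun l => (l == k)%:R); split=> [l||]; first exact: ler0n.
- by rewrite (bigD1 k) //= eqxx big1 ?addr0 // => l /negPf ->.
- rewrite (bigD1 k) //= eqxx scale1r big1 ?addr0 // => l /negPf ->.
  by rewrite scale0r.
Qed.

Lemma convex_conv_family (R : realType) (V : lmodType R) (n : nat)
  (p : 'I_n -> V) : convex_in (conv_family p).
Proof.
move=> x y s [w [w0 w1 ->]] [w' [w'0 w'1 ->]] /andP[s0 s1].
exists (fun k => s * w k + (1 - s) * w' k); split=> [k||].
- by apply: addr_ge0; apply: mulr_ge0; rewrite ?subr_ge0.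
- by rewrite big_split /= -!mulr_sumr w1 w'1; ring.
- rewrite !scaler_sumr -big_split /=; apply: eq_bigr => k _.
  by rewrite [RHS]scalerDl !scalerA.
Qed.

Lemma half_itv (R : realType) : 0 < (2^-1 : R) < 1.
Proof. by apply/andP; split; lra. Qed.

Lemma half_sum (R : realType) (V : lmodType R) (x y z : V) :
  x + y = z + z -> z = 2^-1 *: x + (1 - 2^-1) *: y.
Proof.
have -> : 1 - 2^-1 = 2^-1 :> R by lra.
move=> e; rewrite -scalerDr e scalerDr -scalerDl.
have -> : 2^-1 + 2^-1 = 1 :> R by lra.
by rewrite scale1r.
Qed.

(* x + y is also the midpoint of x + y' and x' + y. *)
Lemma vert_minkowski_sum_inj (R : realType) (V : lmodType R) (A B : set V)
    (x x' y y' : V) :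
  vert (minkowski_sum A B) (x + y) -> A x -> A x' -> B y -> B y' ->
  x + y = x' + y' -> x = x' /\ y = y'.
Proof.
move=> [_ ext] Ax Ax' By By' e.
have xy' : minkowski_sum A B (x + y') by exists x => //; exists y'.
have x'y : minkowski_sum A B (x' + y) by exists x' => //; exists y.
have mid : x + y = 2^-1 *: (x + y') + (1 - 2^-1) *: (x' + y).
  by apply: half_sum; rewrite addrACA [y' + y]addrC addrACA -e.
have [/addrI -> /addIr ->] := ext _ _ _ xy' x'y (half_itv R) mid.
by [].
Qed.

(* If p_k has weight w > 0 in x, then x is the midpoint of
   x + w (p_k - x) and x - w (p_k - x). *)
Lemma conv_family_perturb (R : realType) (V : lmodType R) (n : nat)
    (p : 'I_n -> V) (x : V) :
  conv_family p x -> exists k (e : R),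
    [/\ e != 0, conv_family p (x + e *: (p k - x))
      & conv_family p (x - e *: (p k - x))].
Proof.
move=> px; have [w [w0 w1 xE]] := px.
have [k wk] : exists k, w k != 0.
  apply: contrapT => /forallNP w_eq0; have := w1; rewrite big1 => [/esym/eqP|k _].
    by rewrite oner_eq0.
  by apply/eqP; rewrite -[_ == _]negbK; apply/negP/w_eq0.
have wk1 : w k <= 1 by rewrite -w1 (bigD1 k) //= lerDl sumr_ge0.
exists k, (w k); split=> //.
  have -> : x + w k *: (p k - x) = w k *: p k + (1 - w k) *: x.
    by rewrite scalerBr scalerBl scale1r addrCA.
  by apply: convex_conv_family; rewrite ?w0 //; exact: conv_family_mem.
(* These are the weights of x - w_k (p_k - x). At k they reduce to w_k ^ 2, so they stay
   nonnegative. *)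
exists (fun l => w l + w k * w l - w k * (l == k)%:R); split=> [l||].
- case: eqVneq => [->|_]; last by rewrite mulr0 subr0 addr_ge0 ?mulr_ge0.
  by rewrite mulr1 addrAC subrr add0r mulr_ge0.
- rewrite sumrB big_split /= -!mulr_sumr w1 (bigD1 k) //= eqxx big1.
    by rewrite addr0 !mulr1 addrK.
  by move=> l /negPf ->.
- under eq_bigr do rewrite scalerBl scalerDl -!scalerA.
  rewrite sumrB big_split /= -!scaler_sumr -xE (bigD1 k) //= eqxx big1.
    by rewrite addr0 scale1r scalerBr opprB addrA.
  by move=> l /negPf ->; rewrite scale0r.
Qed.

Lemma minkowski_sumC (V : zmodType) (A B : set V) :
  minkowski_sum A B = minkowski_sum B A.
Proof.
by apply/seteqP; split=> _ [x Ax [y By <-]]; exists y => //; exists x => //;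
  rewrite addrC.
Qed.

(** Perturbing x along p_k - x in both directions, with y fixed, gives two points of the sum with
    midpoint x + y. Extremality makes them coincide, so p_k - x vanishes. *)
Lemma vert_minkowski_suml (R : realType) (V : lmodType R) (n : nat)
    (p : 'I_n -> V) (B : set V) (x y : V) :
  vert (minkowski_sum (conv_family p) B) (x + y) -> conv_family p x -> B y ->
  exists k, x = p k.
Proof.
move=> [_ ext] /conv_family_perturb[k [e [e0 xD xB]]] By; exists k.
have xDy : minkowski_sum (conv_family p) B (x + e *: (p k - x) + y).
  by exists (x + e *: (p k - x)) => //; exists y.
have xBy : minkowski_sum (conv_family p) B (x - e *: (p k - x) + y).
  by exists (x - e *: (p k - x)) => //; exists y.
have mid : x + y = 2^-1 *: (x + e *: (p k - x) + y)
                   + (1 - 2^-1) *: (x - e *: (p k - x) + y).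
  by apply: half_sum; rewrite addrACA [RHS]addrACA; congr +%R;
    rewrite addrACA subrr addr0.
have [/addIr/eqP + _] := ext _ _ _ xDy xBy (half_itv R) mid.
by rewrite -subr_eq0 addrAC subrr add0r scaler_eq0 (negPf e0) subr_eq0
  => /eqP.
Qed.

Lemma vert_minkowski_sum_conv_family (R : realType) (V : lmodType R) (n : nat)
    (p q : 'I_n -> V) (z : V) :
  vert (minkowski_sum (conv_family p) (conv_family q)) z ->
  exists i j, z = p i + q j.
Proof.
move=> vz; have [x px [y qy xy]] := vz.1; rewrite -xy in vz *.
have [i ->] := vert_minkowski_suml vz px qy.
rewrite minkowski_sumC addrC in vz; have [j ->] := vert_minkowski_suml vz qy px.
by exists i, j.
Qed.

(** The gap l (p i) - l x is the weighted sum of the gaps l (p i) - l (p k), all nonnegative. If it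
    is zero, every weight off i is zero. *)
Lemma conv_family_max (R : realType) (V : lmodType R) (n : nat)
    (p : 'I_n -> V) (l : {scalar V}) (i : 'I_n) (x : V) :
  (forall k, k != i -> l (p k) < l (p i)) -> conv_family p x ->
  l x <= l (p i) /\ (l x = l (p i) -> x = p i).
Proof.
move=> pi_max [w [w0 w1 ->]].
have lE : l (p i) - l (\sum_k w k *: p k) = \sum_k w k * (l (p i) - l (p k)).
  rewrite linear_sum /= -{1}[l (p i)]mul1r -w1 mulr_suml -sumrB.
  by apply: eq_bigr => k _; rewrite linearZ mulrBr.
have ge0 k : true -> 0 <= w k * (l (p i) - l (p k)).
  move=> _; rewrite mulr_ge0 // subr_ge0.
  by have [->|/pi_max/ltW] := eqVneq k i.
split; first by rewrite -subr_ge0 lE; apply: sumr_ge0.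
move=> /esym/eqP; rewrite -subr_eq0 lE => /eqP s0.
rewrite -[RHS]scale1r -w1 scaler_suml; apply: eq_bigr => k _.
have [->//|ki] := eqVneq k i.
have /eqP := @psumr_eq0P _ _ _ _ ge0 s0 k isT.
rewrite mulf_eq0 subr_eq0 [l (p i) == _]gt_eqF ?pi_max // orbF => /eqP ->.
by rewrite !scale0r.
Qed.

(** On the sum, l is maximal only where both summands are maximal, hence at a single point. *)
Lemma vert_of_functional (R : realType) (V : lmodType R) (n : nat)
    (p q : 'I_n -> V) (l : {scalar V}) (i j : 'I_n) :
  (forall k, k != i -> l (p k) < l (p i)) ->
  (forall k, k != j -> l (q k) < l (q j)) ->
  vert (minkowski_sum (conv_family p) (conv_family q)) (p i + q j).
Proof.
move=> pmax qmax.
have max z : minkowski_sum (conv_family p) (conv_family q) z ->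
    l z <= l (p i + q j) /\ (l z = l (p i + q j) -> z = p i + q j).
  move=> [x px [y qy <-]]; have [xle xeq] := conv_family_max pmax px.
  have [yle yeq] := conv_family_max qmax qy; rewrite !linearD /=.
  split=> [|e]; first exact: lerD.
  have /eqP : (l (p i) - l x) + (l (q j) - l y) = 0.
    by rewrite addrACA -opprD -e subrr.
  rewrite paddr_eq0 ?subr_ge0 // !subr_eq0.
  by move=> /andP[/eqP/esym/xeq -> /eqP/esym/yeq ->].
split; first by exists (p i); [|exists (q j)] => //; exact: conv_family_mem.
move=> y z s /max[yle yeq] /max[zle zeq] /andP[s0 s1] e.
(* A convex combination of two nonnegative gaps with positive coefficients vanishes, so both gaps
   do. *)
have le0 : s * (l (p i + q j) - l y) + (1 - s) * (l (p i + q j) - l z) = 0.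
  by rewrite {2}e {1}e linearD /= !linearZ /=; ring.
have s1' : 0 < 1 - s by rewrite subr_gt0.
have /eqP := le0; rewrite paddr_eq0 ?mulr_ge0 ?subr_ge0 ?(ltW s0) ?(ltW s1) //.
rewrite !mulf_eq0 (gt_eqF s0) (gt_eqF s1') /= !subr_eq0.
by move=> /andP[/eqP/esym/yeq ? /eqP/esym/zeq ?].
Qed.

(** * Coordinates of the simplex and of its two embeddings *)

Lemma image_conv_family (R : realType) (U V : lmodType R) (n : nat)
    (f : {linear U -> V}) (p : 'I_n -> U) :
  f @` conv_family p = conv_family (f \o p).
Proof.
apply/seteqP; split=> [_ [_ [w [w0 w1 ->]] <-]|_ [w [w0 w1 ->]]].
  exists w; split=> //; rewrite linear_sum; apply: eq_bigr => k _.
  by rewrite linearZ.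
exists (\sum_k w k *: p k); first by exists w.
by rewrite linear_sum; apply: eq_bigr => k _; rewrite linearZ.
Qed.

Lemma sum_nat_ltn (R : pzRingType) (n i : nat) (F : nat -> R) : (i <= n)%N ->
  \sum_(k < n) (if (k < i)%N then F k else 0) = \sum_(0 <= k < i) F k.
Proof.
move=> le_in; rewrite -big_mkcond big_mkord.
by rewrite (big_ord_widen n (fun k => F k)).
Qed.

Lemma pad_linear (R : realType) (n d : nat) : linear (@pad R n d).
Proof.
by move=> s x y; rewrite /pad scale_row_mx add_row_mx scaler0 addr0.
Qed.

HB.instance Definition _ (R : realType) (n d : nat) :=
  GRing.isLinear.Build R 'rV[R]_n 'rV[R]_(n + d) *:%R (@pad R n d)
    (@pad_linear R n d).

Lemma shift_linear (R : realType) (n d : nat) : linear (@shift R n d).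
Proof.
move=> s x y; apply/rowP => k; rewrite !mxE !castmxE /= !mxE.
by case: fintype.split => l; rewrite !mxE ?mulr0 ?addr0.
Qed.

HB.instance Definition _ (R : realType) (n d : nat) :=
  GRing.isLinear.Build R 'rV[R]_n 'rV[R]_(n + d) *:%R (@shift R n d)
    (@shift_linear R n d).

Lemma pad_row (R : realType) (n d : nat) (X : nat -> R) :
  pad d (\row_(k < n) X k) = \row_k (if (k < n)%N then X k else 0).
Proof.
by apply/rowP => k; rewrite !mxE; case: splitP => l; rewrite mxE // => ->.
Qed.

Lemma shift_row (R : realType) (n d : nat) (X : nat -> R) :
  shift d (\row_(k < n) X k) = \row_k (if (d <= k)%N then X (k - d)%N else 0).
Proof.
apply/rowP => k; rewrite mxE castmxE /= !mxE; rewrite leqNgt.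
case: splitP => l /= lE; rewrite !mxE lE; first by rewrite ltn_ord.
by rewrite ltnNge leq_addr addKn.
Qed.

Lemma pad_inj (R : realType) (n d : nat) : injective (@pad R n d).
Proof. by move=> x y /eq_row_mx[]. Qed.

Lemma shift_inj (R : realType) (n d : nat) : injective (@shift R n d).
Proof. by move=> x y /(can_inj (castmxK _ _)) /eq_row_mx[]. Qed.

Lemma ra_v_row (R : realType) (n : nat) (b : nat -> nat) (i : nat) :
  ra_v R (fun k : 'I_n => b k) i =
  \row_(k < n) ((b k)%:R * (k < i)%N%:R).
Proof. by apply/rowP => k; rewrite !mxE; case: ifP; rewrite ?mulr1 ?mulr0. Qed.

Lemma RA_conv_family (R : realType) (n : nat) (a : 'I_n -> nat) (d : nat) :
  RA R a d = minkowski_sum (conv_family (fun i : 'I_n => pad d (ra_v R a i.+1)))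
                           (conv_family (fun j : 'I_n => shift d (ra_v R a j.+1))).
Proof. by rewrite /RA /right_angle_simplex !image_conv_family. Qed.

(* In the coordinates h_k = x_(k+1) / a_(k+1), the simplex is
   1 = h_0 >= h_1 >= ... >= h_(n-1) >= 0. *)
Lemma right_angle_simplex_row (R : realType) (n : nat) (b : nat -> nat)
    (h : nat -> R) :
  h 0 = 1 -> h n = 0 -> (forall k, (k < n)%N -> h k.+1 <= h k) ->
  right_angle_simplex R (fun k : 'I_n => b k)
    (\row_(k < n) ((b k)%:R * h k)).
Proof.
move=> h0 hn hmono.
have tail m : (m <= n)%N -> \sum_(m <= l < n) (h l - h l.+1) = h m.
  move=> lemn; rewrite -[LHS]opprK -sumrN; under eq_bigr do rewrite opprB.
  by rewrite telescope_sumr // hn sub0r opprK.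
(* The weight of the point with ordinal l is the drop of h after l. Coordinate k collects the drops
   from k on, which telescope to h k because h n = 0. *)
exists (fun l => h l - h l.+1); split=> [l||].
- by rewrite subr_ge0 hmono.
- by rewrite -(big_mkord xpredT (fun l => h l - h l.+1)) tail.
apply/rowP => k; rewrite summxE !mxE.
under eq_bigr do rewrite !mxE mulrC.
rewrite -(tail _ (ltnW (ltn_ord k))) big_distrr /= (big_nat_widenl k 0) // big_mkord.
rewrite big_mkcond; apply: eq_bigr => l _.
by rewrite ltnS; case: (k <= l)%N; rewrite ?mul0r.
Qed.

(** * Coordinate criteria for being a vertex or not *)

Definition coord_form (R : realType) (N : nat) (c : nat -> R) (x : 'rV[R]_N) : R :=
  \sum_(k < N) c k * x 0 k.

Lemma coord_form_linear (R : realType) (N : nat) (c : nat -> R) :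
  scalar (@coord_form R N c).
Proof.
move=> s x y; rewrite /coord_form mulr_sumr -big_split; apply: eq_bigr => k _.
by rewrite !mxE /=; ring.
Qed.

HB.instance Definition _ (R : realType) (N : nat) (c : nat -> R) :=
  GRing.isLinear.Build R 'rV[R]_N R *%R (@coord_form R N c)
    (@coord_form_linear R N c).

Lemma coord_form_pad (R : realType) (n d : nat) (b : nat -> nat) (c : nat -> R)
    (i : nat) : (i <= n)%N ->
  coord_form c (pad d (ra_v R (fun k : 'I_n => b k) i)) =
  \sum_(0 <= k < i) c k * (b k)%:R.
Proof.
move=> le_in; rewrite -(sum_nat_ltn _ le_in) /coord_form big_split_ord /=.
rewrite [X in _ + X]big1 ?addr0 => [|k _]; last by rewrite row_mxEr mxE mulr0.
apply: eq_bigr => k _; rewrite row_mxEl mxE.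
by case: ifP => // _; rewrite mulr0.
Qed.

Lemma coord_form_shift (R : realType) (n d : nat) (b : nat -> nat)
    (c : nat -> R) (j : nat) : (j <= n)%N ->
  coord_form c (shift d (ra_v R (fun k : 'I_n => b k) j)) =
  \sum_(0 <= k < j) c (d + k)%N * (b k)%:R.
Proof.
move=> le_jn; rewrite -(sum_nat_ltn _ le_jn) ra_v_row.
rewrite (shift_row n d (fun k => (b k)%:R * (k < j)%N%:R)) /coord_form.
under eq_bigr do rewrite mxE.
rewrite -(big_mkord xpredT (fun k => c k *
  (if (d <= k)%N then (b (k - d)%N)%:R * (k - d < j)%N%:R else 0))).
rewrite (@big_cat_nat _ _ _ d) ?leq_addl //= big1_seq ?add0r; last first.
  by move=> k /=; rewrite mem_index_iota => /andP[_ kd]; rewrite leqNgt kd mulr0.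
rewrite -{1}[d]add0n big_addn addnK big_mkord; apply: eq_bigr => k _.
by rewrite leq_addl addnK addnC; case: ifP; rewrite ?mulr1 ?mulr0.
Qed.

(** Two partial sums differ by a block of consecutive terms, so comparing with index i involves only
    blocks that end at i or start at i + 1. Term 0 lies in every partial sum, hence l > 0. *)
Lemma sum_nat_strict_max (R : realType) (n i : nat) (y : nat -> R) :
  (i < n)%N ->
  (forall l, (0 < l <= i)%N -> 0 < \sum_(l <= k < i.+1) y k) ->
  (forall l, (i.+1 < l <= n)%N -> \sum_(i.+1 <= k < l) y k < 0) ->
  forall l : 'I_n, l != i :> nat ->
    \sum_(0 <= k < l.+1) y k < \sum_(0 <= k < i.+1) y k.
Proof.
move=> lt_in below above l; rewrite neq_ltn => /orP[lt_li|lt_il].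
- rewrite [ltRHS](@big_cat_nat _ _ _ l.+1) //=; last by lia.
  by rewrite ltrDl below //; lia.
- rewrite [ltLHS](@big_cat_nat _ _ _ i.+1) //=; last by lia.
  by rewrite gtrDl above //; have := ltn_ord l; lia.
Qed.

Lemma vert_ra_point (R : realType) (n d : nat) (b : nat -> nat) (c : nat -> R)
    (i j : 'I_n) :
  (forall l, (0 < l <= i)%N -> 0 < \sum_(l <= k < i.+1) c k * (b k)%:R) ->
  (forall l, (i.+1 < l <= n)%N -> \sum_(i.+1 <= k < l) c k * (b k)%:R < 0) ->
  (forall l, (0 < l <= j)%N ->
     0 < \sum_(l <= k < j.+1) c (d + k)%N * (b k)%:R) ->
  (forall l, (j.+1 < l <= n)%N ->
     \sum_(j.+1 <= k < l) c (d + k)%N * (b k)%:R < 0) ->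
  vert (RA R (fun k : 'I_n => b k) d) (ra_point R (fun k : 'I_n => b k) d i.+1 j.+1).
Proof.
move=> ib ia jb ja; rewrite RA_conv_family /ra_point.
pose p (i : 'I_n) := pad d (ra_v R (fun k : 'I_n => b k) i.+1).
pose q (i : 'I_n) := shift d (ra_v R (fun k : 'I_n => b k) i.+1).
apply: (@vert_of_functional R _ n p q (@coord_form R (n + d) c) i j) => k ne.
  rewrite /= !coord_form_pad //.
  exact: (sum_nat_strict_max (y := fun k => c k * (b k)%:R)).
rewrite /= !coord_form_shift //.
exact: (sum_nat_strict_max (y := fun k => c (d + k)%N * (b k)%:R)).
Qed.

(** [h] and [h'] describe a second decomposition of the point, in the coordinates of
    [right_angle_simplex_row]. The last premise makes its shifted part differ from the original one,
    against [vert_minkowski_sum_inj]. *)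
Lemma not_vert_ra_point (R : realType) (n d : nat) (b : nat -> nat)
    (i j : 'I_n) (h h' : nat -> R) :
  h 0 = 1 -> h n = 0 -> (forall k, (k < n)%N -> h k.+1 <= h k) ->
  h' 0 = 1 -> h' n = 0 -> (forall k, (k < n)%N -> h' k.+1 <= h' k) ->
  (forall k, (k < n + d)%N ->
    (if (k < n)%N then (b k)%:R * (k < i.+1)%N%:R else 0)
    + (if (d <= k)%N then (b (k - d)%N)%:R * (k - d < j.+1)%N%:R else 0) =
    (if (k < n)%N then (b k)%:R * h k else 0)
    + (if (d <= k)%N then (b (k - d)%N)%:R * h' (k - d)%N else 0)) ->
  (exists2 k : 'I_n, (0 < b k)%N & h' k != (k < j.+1)%N%:R) ->
  ~ vert (RA R (fun k : 'I_n => b k) d) (ra_point R (fun k : 'I_n => b k) d i.+1 j.+1).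
Proof.
move=> h0 hn hm h'0 h'n h'm e [k bk ne] v.
have mem (l : 'I_n) : right_angle_simplex R (fun k : 'I_n => b k)
    (ra_v R (fun k : 'I_n => b k) l.+1).
  exact: (conv_family_mem (fun l : 'I_n => ra_v R (fun k : 'I_n => b k) l.+1)).
have [|||||_ /shift_inj] := @vert_minkowski_sum_inj _ _ _ _
    _ (pad d (\row_(k < n) ((b k)%:R * h k)))
    _ (shift d (\row_(k < n) ((b k)%:R * h' k))) v.
- by exists (ra_v R (fun k : 'I_n => b k) i.+1).
- exists (\row_(k < n) ((b k)%:R * h k)) => //.
  exact: right_angle_simplex_row.
- by exists (ra_v R (fun k : 'I_n => b k) j.+1).
- exists (\row_(k < n) ((b k)%:R * h' k)) => //.
  exact: right_angle_simplex_row.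
- rewrite !ra_v_row; apply/rowP => l.
  rewrite (pad_row n d (fun k => (b k)%:R * h k)).
  rewrite (pad_row n d (fun k => (b k)%:R * (k < i.+1)%N%:R)).
  rewrite (shift_row n d (fun k => (b k)%:R * h' k)).
  rewrite (shift_row n d (fun k => (b k)%:R * (k < j.+1)%N%:R)).
  by rewrite !mxE e.
rewrite ra_v_row => /rowP/(_ k); rewrite !mxE => /mulfI bE.
by move/eqP: ne; apply; rewrite bE // pnatr_eq0 -lt0n.
Qed.

Lemma ra_point_inj (R : realType) (n d : nat) (b : nat -> nat)
    (i j i' j' : 'I_n) : (forall k, (k < n)%N -> (0 < b k)%N) ->
  vert (RA R (fun k : 'I_n => b k) d) (ra_point R (fun k : 'I_n => b k) d i.+1 j.+1) ->
  ra_point R (fun k : 'I_n => b k) d i.+1 j.+1 =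
  ra_point R (fun k : 'I_n => b k) d i'.+1 j'.+1 -> i = i' /\ j = j'.
Proof.
move=> b_gt0; rewrite RA_conv_family => v e.
(* Reading coordinate l gives one inequality; the equality of indices comes from using it in both
   directions. *)
have ra_v_inj (k l : 'I_n) : ra_v R (fun k : 'I_n => b k) k.+1 =
    ra_v R (fun k : 'I_n => b k) l.+1 -> (l <= k)%N.
  rewrite !ra_v_row => /rowP/(_ l); rewrite !mxE ltnSn => /mulfI.
  rewrite pnatr_eq0 -lt0n b_gt0 // => /(_ isT)/eqP.
  by rewrite ltnS eq_sym; case: leqP => //; rewrite oner_eq0.
have [||||/pad_inj vE /shift_inj uE] := vert_minkowski_sum_inj v _ _ _ _ e.
- exact: (conv_family_mem (fun i : 'I_n => pad d (ra_v R _ i.+1))).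
- exact: (conv_family_mem (fun i : 'I_n => pad d (ra_v R _ i.+1))).
- exact: (conv_family_mem (fun i : 'I_n => shift d (ra_v R _ i.+1))).
- exact: (conv_family_mem (fun i : 'I_n => shift d (ra_v R _ i.+1))).
by split; apply/val_inj/eqP; rewrite /= eqn_leq !ra_v_inj.
Qed.

(** * Signs and bounds of sums over blocks *)

Lemma sum_nat_gt0 (R : numDomainType) (l u : nat) (y : nat -> R) :
  (l < u)%N -> (forall k, (l <= k < u)%N -> 0 < y k) -> 0 < \sum_(l <= k < u) y k.
Proof.
move=> lu y_gt0; rewrite big_ltn // ltr_wpDr ?y_gt0 ?leqnn //.
by rewrite big_seq sumr_ge0 // => k; rewrite mem_index_iota => ?; rewrite ltW ?y_gt0; lia.
Qed.

Lemma sum_nat_lt0 (R : numDomainType) (l u : nat) (y : nat -> R) :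
  (l < u)%N -> (forall k, (l <= k < u)%N -> y k < 0) -> \sum_(l <= k < u) y k < 0.
Proof.
move=> lu y_lt0; rewrite -oppr_gt0 -sumrN sum_nat_gt0 // => k /y_lt0.
by rewrite oppr_gt0.
Qed.

Lemma sum_nat_delta (R : pzSemiRingType) (l u e : nat) (x : R) :
  \sum_(l <= k < u) (k == e)%:R * x = (l <= e < u)%N%:R * x.
Proof.
have [/andP[le eu]|e_out] := boolP (l <= e < u)%N.
  rewrite (bigD1_seq e) ?mem_index_iota ?iota_uniq ?le ?eu //= eqxx.
  by rewrite big1 ?addr0 // => k /negPf ->; rewrite mul0r.
rewrite mul0r big_seq big1 // => k; rewrite mem_index_iota.
by have [->|] := eqVneq k e; rewrite ?(negPf e_out) ?mul0r.
Qed.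

(** Meant for functionals with two exceptional weights: a block is bounded by those of the two
    positions that it contains. *)
Lemma sum_nat_ge_delta2 (R : numDomainType) (l u e f : nat) (y : nat -> R)
    (x z : R) :
  (forall k, (l <= k < u)%N -> (k == e)%:R * x + (k == f)%:R * z <= y k) ->
  (l <= e < u)%N%:R * x + (l <= f < u)%N%:R * z <= \sum_(l <= k < u) y k.
Proof.
move=> y_ge; rewrite -!sum_nat_delta -big_split ler_sum_nat //.
Qed.

(** Provides the bound S, the same for all blocks, that a single weight of size 1 + S has to
    beat. *)
Lemma sum_nat_le_total (R : numDomainType) (n l u : nat) (b : nat -> nat)
    (c : nat -> R) :
  (u <= n)%N -> (forall k, (l <= k < u)%N -> c k <= 1) ->
  \sum_(l <= k < u) c k * (b k)%:R <= (\sum_(0 <= k < n) b k)%N%:R.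
Proof.
move=> un c_le1; apply: (@le_trans _ _ (\sum_(l <= k < u) (b k)%:R)).
  by apply: ler_sum_nat => k /c_le1 ck; rewrite ler_piMl ?ler0n.
rewrite -natr_sum ler_nat; have [lu|ul] := leqP l u; last by rewrite big_geq // ltnW.
by rewrite (@big_cat_nat _ _ _ l 0 n) ?(leq_trans lu) //=
  (@big_cat_nat _ _ _ u l n) //=; lia.
Qed.

(** * Isolating functionals for the nonzero entries *)

Lemma vert_ra_point_le (R : realType) (n d : nat) (b : nat -> nat) (i j : 'I_n) :
  (forall k, (k < n)%N -> (0 < b k)%N) -> (i < d)%N ->
  vert (RA R (fun k : 'I_n => b k) d) (ra_point R (fun k : 'I_n => b k) d i.+1 j.+1).
Proof.
move=> b_gt0 lt_id; have lt_in := ltn_ord i; have lt_jn := ltn_ord j.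
pose S : R := (\sum_(0 <= k < n) b k)%N%:R.
have S_ge0 : 0 <= S by exact: ler0n.
(* Position i + 1 is at most d, where all the u's have the same entry, so the huge negative weight
   only penalises the v's beyond i. *)
pose c (k : nat) : R := if (k <= i)%N then 1 else if k == i.+1 then - (1 + S)
  else if (k <= d + j)%N then 1 else -1.
have bR k : (k < n)%N -> 1 <= (b k)%:R :> R by move=> /b_gt0; rewrite ler1n.
apply: (vert_ra_point (c := c)) => l l_in.
- apply: sum_nat_gt0 => [|k k_in]; first by lia.
  have -> : c k = 1 by rewrite /c ifT //; lia.
  by rewrite mul1r (lt_le_trans ltr01) ?bR //; lia.
- rewrite big_ltn; last by lia.
  have -> : c i.+1 = - (1 + S) by rewrite /c ltnn eqxx.
  have : \sum_(i.+2 <= k < l) c k * (b k)%:R <= S.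
    apply: sum_nat_le_total => [|k k_in]; first by lia.
    by rewrite /c; do !case: ifP => _; lra.
  have : 1 <= (b i.+1)%:R :> R by rewrite bR //; lia.
  by move: (\sum_(_ <= _ < _) _) (_%:R) => X B; nra.
- apply: sum_nat_gt0 => [|k k_in]; first by lia.
  have -> : c (d + k)%N = 1.
    by rewrite /c ifF 1?ifF 1?ifT //; lia.
  by rewrite mul1r (lt_le_trans ltr01) ?bR //; lia.
- apply: sum_nat_lt0 => [|k k_in]; first by lia.
  have -> : c (d + k)%N = -1.
    by rewrite /c ifF ?ifF ?ifF //; lia.
  by rewrite mulN1r oppr_lt0 (lt_le_trans ltr01) ?bR //; lia.
Qed.

Lemma vert_ra_point_ge (R : realType) (n d : nat) (b : nat -> nat) (i j : 'I_n) :
  (forall k, (k < n)%N -> (0 < b k)%N) -> (n <= d + j)%N ->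
  vert (RA R (fun k : 'I_n => b k) d) (ra_point R (fun k : 'I_n => b k) d i.+1 j.+1).
Proof.
move=> b_gt0 le_ndj; have lt_in := ltn_ord i; have lt_jn := ltn_ord j.
pose S : R := (\sum_(0 <= k < n) b k)%N%:R.
have S_ge0 : 0 <= S by exact: ler0n.
(* Position d + j is at least n, outside the support of the v's. The weight 1 + S there acts on the
   u's only and outweighs any -1 before it. *)
pose c (k : nat) : R := if (k <= i)%N then 1 else if k == (d + j)%N then 1 + S
  else -1.
have bR k : (k < n)%N -> 1 <= (b k)%:R :> R by move=> /b_gt0; rewrite ler1n.
apply: (vert_ra_point (c := c)) => l l_in.
- apply: sum_nat_gt0 => [|k k_in]; first by lia.
  have -> : c k = 1 by rewrite /c ifT //; lia.
  by rewrite mul1r (lt_le_trans ltr01) ?bR //; lia.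
- apply: sum_nat_lt0 => [|k k_in]; first by lia.
  have -> : c k = -1 by rewrite /c ifF ?ifF //; lia.
  by rewrite mulN1r oppr_lt0 (lt_le_trans ltr01) ?bR //; lia.
- rewrite big_nat_recr; last by lia.
  have -> : c (d + j)%N = 1 + S by rewrite /c ifF ?eqxx //; lia.
  have : - \sum_(l <= k < j) c (d + k)%N * (b k)%:R <= S.
    rewrite -sumrN; under eq_bigr do rewrite -mulNr.
    apply: sum_nat_le_total => [|k k_in]; first by lia.
    by rewrite /c; do !case: ifP => _; lra.
  have := bR j lt_jn.
  by move: (\sum_(_ <= _ < _) _) (_%:R) => X B /=; nra.
- apply: sum_nat_lt0 => [|k k_in]; first by lia.
  have -> : c (d + k)%N = -1.
    by rewrite /c ifF ?ifF //; lia.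
  by rewrite mulN1r oppr_lt0 (lt_le_trans ltr01) ?bR //; lia.
Qed.

Lemma vert_ra_point_diag (R : realType) (n d : nat) (b : nat -> nat) (i j : 'I_n) :
  (forall k, (k < n)%N -> (0 < b k)%N) -> i = (d + j)%N :> nat ->
  vert (RA R (fun k : 'I_n => b k) d) (ra_point R (fun k : 'I_n => b k) d i.+1 j.+1).
Proof.
move=> b_gt0 ij; have lt_in := ltn_ord i; have lt_jn := ltn_ord j.
pose c (k : nat) : R := if (k <= i)%N then 1 else -1.
have bR k : (k < n)%N -> 0 < (b k)%:R :> R by move=> /b_gt0; rewrite ltr0n.
apply: (vert_ra_point (c := c)) => l l_in.
- apply: sum_nat_gt0 => [|k k_in]; first by lia.
  by rewrite /c ifT ?mul1r ?bR //; lia.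
- apply: sum_nat_lt0 => [|k k_in]; first by lia.
  by rewrite /c ifF ?mulN1r ?oppr_lt0 ?bR //; lia.
- apply: sum_nat_gt0 => [|k k_in]; first by lia.
  by rewrite /c ifT ?mul1r ?bR //; lia.
- apply: sum_nat_lt0 => [|k k_in]; first by lia.
  by rewrite /c ifF ?mulN1r ?oppr_lt0 ?bR //; lia.
Qed.

Lemma vert_ra_point_above (R : realType) (n d : nat) (b : nat -> nat) (i j : 'I_n) :
  (forall k, (k < n)%N -> (0 < b k)%N) ->
  (forall k l, (k < l)%N -> (d + l < n)%N ->
    (b k * b (d + l) < b l * b (d + k))%N) ->
  (d <= i)%N -> (i.+1 < d + j)%N -> (d + j < n)%N ->
  vert (RA R (fun k : 'I_n => b k) d) (ra_point R (fun k : 'I_n => b k) d i.+1 j.+1).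
Proof.
move=> b_gt0 b_mono le_di lt_ij lt_dj; have lt_in := ltn_ord i; have lt_jn := ltn_ord j.
pose t := (i.+1 - d)%N; have it : i.+1 = (d + t)%N by rewrite /t; lia.
(* The weights -p and q at positions i + 1 and d + j must satisfy
   b_t / b_j < q / p < b_(d+t) / b_(d+j); q / p is the mediant. *)
pose p : R := (b (d + j) + b j)%N%:R; pose q : R := (b (d + t) + b t)%N%:R.
pose c (k : nat) : R := if (k <= i)%N then 1 else if k == i.+1 then - p
  else if (k < d + j)%N then 0 else if k == (d + j)%N then q else -1.
have bR k : (k < n)%N -> 0 < (b k)%:R :> R by move=> /b_gt0; rewrite ltr0n.
have q0 : 0 < q by rewrite ltr0n addn_gt0 b_gt0 //; lia.
have key : (b t)%:R * (b (d + j)%N)%:R < (b j)%:R * (b (d + t)%N)%:R :> R.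
  by rewrite -!natrM ltr_nat b_mono //; lia.
have p0 : 0 < p by rewrite ltr0n addn_gt0 b_gt0 //; lia.
(* [keyf] makes a block of the v's negative when it reaches both i + 1 and d + j; [keyg] makes a
   block of the u's positive when it contains both. *)
have keyf : q * (b (d + j)%N)%:R - p * (b (d + t)%N)%:R < 0.
  by rewrite /p /q !natrD; nra.
have keyg : 0 < q * (b j)%:R - p * (b t)%:R.
  by rewrite /p /q !natrD; nra.
apply: (vert_ra_point (c := c)) => l l_in.
- apply: sum_nat_gt0 => [|k k_in]; first by lia.
  by rewrite /c ifT ?mul1r ?bR //; lia.
- rewrite -oppr_gt0 -sumrN.
  have : (i.+1 <= i.+1 < l)%N%:R * (p * (b (d + t)%N)%:R) +
      (i.+1 <= d + j < l)%N%:R * (- (q * (b (d + j)%N)%:R)) <=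
      \sum_(i.+1 <= k < l) - (c k * (b k)%:R).
    apply: sum_nat_ge_delta2 => k k_in; rewrite -it.
    have bk : 0 < (b k)%:R :> R by rewrite bR; lia.
    rewrite /c ifF; last by lia.
    case: eqVneq => [->|ne1].
      by rewrite (_ : (_ == _) = false) /=; [lra | lia].
    by case: ltngtP => [lt_k|lt_k|->] /=; lra.
  rewrite (_ : (_ <= i.+1 < l)%N = true); last by lia.
  apply: lt_le_trans; have : 0 < p * (b (d + t)%N)%:R.
    by rewrite mulr_gt0 // bR; lia.
  by case: (_ <= d + j < l)%N => /=; lra.
- have : (l <= t < j.+1)%N%:R * (- (p * (b t)%:R)) +
      (l <= j < j.+1)%N%:R * (q * (b j)%:R) <=
      \sum_(l <= k < j.+1) c (d + k)%N * (b k)%:R.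
    apply: sum_nat_ge_delta2 => k k_in.
    have bk : 0 < (b k)%:R :> R by rewrite bR; lia.
    rewrite /c it.
    have [lt_kt|lt_tk|->] := ltngtP k t.
    + rewrite ifT; last by lia.
      by rewrite (_ : (_ == _) = false) /=; [lra | lia].
    + rewrite ifF 1?ifF; try lia.
      rewrite ltn_add2l eqn_add2l.
      have [lt_kj|lt_jk|->] /= := ltngtP k j; [lra | lia | lra].
    + rewrite ifF ?eqxx; last by lia.
      by rewrite (_ : (_ == _) = false) /=; [lra | lia].
  rewrite [(l <= j < _)%N](_ : _ = true); last by lia.
  apply: lt_le_trans; have : 0 < q * (b j)%:R by rewrite mulr_gt0 // bR.
  by case: (_ <= t < _)%N => /=; lra.
- apply: sum_nat_lt0 => [|k k_in]; first by lia.
  have -> : c (d + k)%N = -1.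
    by rewrite /c ifF ?ifF ?ifF ?ifF //; lia.
  by rewrite mulN1r oppr_lt0 ?bR //; lia.
Qed.

(** * Second decompositions for the zero entries *)

Lemma not_vert_ra_point_succ (R : realType) (n d : nat) (b : nat -> nat)
    (i j : 'I_n) :
  (forall k, (k < n)%N -> (0 < b k)%N) ->
  (0 < j)%N -> (d + j)%N = i.+1 -> (i.+1 < n)%N ->
  ~ vert (RA R (fun k : 'I_n => b k) d) (ra_point R (fun k : 'I_n => b k) d i.+1 j.+1).
Proof.
move=> b_gt0 j0 ji lt_in; have lt_jn := ltn_ord j.
(* At position i + 1 = d + j the original point has entry b_j, all of it from u_j. Giving both new
   summands the fraction e there requires e (b_j + b_(i+1)) = b_j. *)
pose e : R := (b j)%:R / ((b j)%:R + (b i.+1)%:R).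
have bR k : (k < n)%N -> 0 < (b k)%:R :> R by move=> /b_gt0; rewrite ltr0n.
have bj := bR _ lt_jn; have bi := bR _ lt_in.
have e0 : 0 < e by rewrite divr_gt0 // addr_gt0.
have e1 : e < 1 by rewrite ltr_pdivrMr ?mul1r ?addr_gt0 // ltrDl.
pose h (k : nat) : R := if (k <= i)%N then 1 else if k == i.+1 then e else 0.
pose h' (k : nat) : R := if (k < j)%N then 1 else if k == j then e else 0.
apply: (not_vert_ra_point (h := h) (h' := h')).
- by [].
- by rewrite /h ifF ?ifF //; lia.
- by move=> k _; rewrite /h; do !case: ifPn => ?; try lra; lia.
- by rewrite /h' j0.
- by rewrite /h' ifF ?ifF //; lia.
- by move=> k _; rewrite /h'; do !case: ifPn => ?; try lra; lia.
- move=> k k_in; rewrite /h /h'.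
  have [lt_k|lt_k|->] := ltngtP k (i.+1).
  + rewrite (_ : (k <= i)%N = true) //.
    case: (leqP d k) => dk //.
    have lt_kj : (k - d < j)%N by lia.
    by rewrite [(_ < j.+1)%N]ltnS lt_kj (ltnW lt_kj).
  + rewrite (_ : (k <= i)%N = false); last by lia.
    rewrite [(_ < j.+1)%N]ltnS (_ : (k - d <= j)%N = false); last by lia.
    rewrite (_ : (k - d < j)%N = false); last by lia.
    by rewrite (_ : (k - d == j)%N = false); last by lia.
  + rewrite /e lt_in ltnn -ji leq_addr addKn eqxx ltnSn ltnn mulr0 mulr1 add0r.
    by field; rewrite gt_eqF // addr_gt0 // ji.
- exists j; first exact: b_gt0.
  by rewrite /h' ltnn eqxx ltnSn lt_eqF.
Qed.

Lemma not_vert_ra_point_below (R : realType) (n d : nat) (b : nat -> nat)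
    (i j : 'I_n) :
  (forall k, (k < n)%N -> (0 < b k)%N) ->
  (forall k l, (k < l)%N -> (d + l < n)%N ->
    (b k * b (d + l) < b l * b (d + k))%N) ->
  (d + j < i)%N ->
  ~ vert (RA R (fun k : 'I_n => b k) d) (ra_point R (fun k : 'I_n => b k) d i.+1 j.+1).
Proof.
move=> b_gt0 b_mono lt_ji; have lt_in := ltn_ord i; have lt_jn := ltn_ord j.
pose s := (i - d)%N; have iE : nat_of_ord i = (d + s)%N by rewrite /s; lia.
(* This is 1 / (1 + r_i) for the ratio r below, so both e and e r_i are less than 1. *)
pose e : R := (b i)%:R / ((b s)%:R + (b i)%:R).
have bR k : (k < n)%N -> 0 < (b k)%:R :> R by move=> /b_gt0; rewrite ltr0n.
have bs : 0 < (b s)%:R :> R by rewrite bR //; lia.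
have bi := bR _ lt_in.
have e0 : 0 < e by rewrite divr_gt0 // addr_gt0.
have e1 : e < 1 by rewrite ltr_pdivrMr ?mul1r ?addr_gt0 // ltrDr.
(* Raising [h'] by e at k - d must be offset by lowering [h] by e r_k at k. The new [h] decreases
   because r increases, and ends nonnegative because e r_i <= 1. *)
pose r (k : nat) : R := (b (k - d)%N)%:R / (b k)%:R.
have r_ge0 k : 0 <= r k by rewrite divr_ge0.
have r_mono k : (d <= k)%N -> (k.+1 < n)%N -> r k <= r k.+1.
  move=> dk kn; rewrite ler_pdivrMr; last by rewrite bR; lia.
  rewrite mulrAC ler_pdivlMr; last by rewrite bR.
  rewrite -!natrM ler_nat; have := b_mono (k - d)%N (k.+1 - d)%N.
  by rewrite !subnKC; lia.
have ri : e * r i <= 1.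
  have -> : e * r i = (b s)%:R / ((b s)%:R + (b i)%:R).
    by rewrite /e /r -/s; field; rewrite !gt_eqF // addr_gt0.
  by rewrite ler_pdivrMr ?mul1r ?addr_gt0 // lerDl ltW.
pose h (k : nat) : R := if (k <= d + j)%N then 1 else
  if (k <= i)%N then 1 - e * r k else 0.
pose h' (k : nat) : R := if (k <= j)%N then 1 else if (k <= s)%N then e else 0.
apply: (not_vert_ra_point (h := h) (h' := h')).
- by [].
- by rewrite /h ifF ?ifF //; lia.
- move=> k kn; rewrite /h.
  have [lek|ltk] := leqP k.+1 (d + j); first by rewrite ifT // ltnW.
  have [leki|ltki] := leqP k.+1 i.
    case: leqP => ltk'; first by rewrite gerBl mulr_ge0 // ltW.
    rewrite ltnW // lerD2l lerN2 ler_pM2l // r_mono //; lia.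
  case: leqP => // ltk'; case: leqP => // leki.
  have -> : k = i by lia.
  by rewrite subr_ge0.
- by [].
- by rewrite /h' ifF ?ifF //; lia.
- by move=> k _; rewrite /h'; do !case: ifPn => ?; try lra; lia.
- move=> k k_in; rewrite /h /h' !ltnS.
  have [lt_k|lt_k] := leqP k (d + j).
    rewrite (_ : (k <= i)%N = true); last by lia.
    by rewrite (_ : (k - d <= j)%N = true) //; lia.
  rewrite (_ : (k - d <= j)%N = false); last by lia.
  have [le_ki|lt_ik] := leqP k i; last first.
    by rewrite (_ : (k - d <= s)%N = false) //; lia.
  rewrite (_ : (k - d <= s)%N = true); last by lia.
  rewrite (_ : (k < n)%N = true); last by lia.
  rewrite (_ : (d <= k)%N = true); last by lia.
  by rewrite /r mulr0 mulr1 addr0; field; rewrite gt_eqF // bR //; lia.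
(* Position j + 1 is at most s, so [h'] takes the value e there instead of 0. *)
- have lt_j : (j.+1 < n)%N by lia.
  exists (Ordinal lt_j); first exact: b_gt0.
  rewrite /h' /= !ltnn ifT; last by lia.
  exact: lt0r_neq0.
Qed.

(** * Strict log-concavity of the binomial coefficients *)

Lemma bin_log_concave1 (n k l : nat) : (k < l)%N -> (l <= n)%N ->
  ('C(n, k) * 'C(n, l.+1) < 'C(n, l) * 'C(n, k.+1))%N.
Proof.
move=> lt_kl le_ln.
have Ck : (0 < 'C(n, k))%N by rewrite bin_gt0; lia.
have Cl : (0 < 'C(n, l))%N by rewrite bin_gt0.
(* Cross-multiplied form of C(n, k+1) / C(n, k) = (n - k) / (k + 1), which decreases strictly in
   k. *)
have Sk := mul_bin_left n k; have Sl := mul_bin_left n l.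
rewrite -(@ltn_pmul2l (k.+1 * l.+1)) //.
rewrite [ltnLHS]mulnACA Sl [ltnLHS]mulnACA.
rewrite [('C(n, l) * _)%N]mulnC [ltnRHS]mulnACA Sk [ltnRHS]mulnACA.
by rewrite ltn_pmul2r ?muln_gt0 ?Ck ?Cl // mulnC ltn_mul //; lia.
Qed.

(** C(n, k+d) / C(n, k) is a product of d successive ratios. The induction multiplies the inequality
    for d by the one-step inequality and cancels the common factors. *)
Lemma bin_log_concave (n k l d : nat) : (0 < d)%N -> (k < l)%N -> (l + d <= n)%N ->
  ('C(n, k) * 'C(n, l + d) < 'C(n, l) * 'C(n, k + d))%N.
Proof.
move=> + lt_kl; case: d => // d _; elim: d => [|d IHd] le_ldn.
  by rewrite !addn1 bin_log_concave1 //; lia.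
have {}IHd : ('C(n, k) * 'C(n, l + d.+1) < 'C(n, l) * 'C(n, k + d.+1))%N.
  by apply: IHd; lia.
have step : ('C(n, k + d.+1) * 'C(n, l + d.+2) <
             'C(n, l + d.+1) * 'C(n, k + d.+2))%N.
  by rewrite [(l + d.+2)%N]addnS [(k + d.+2)%N]addnS bin_log_concave1 //; lia.
have C1 : (0 < 'C(n, k + d.+1))%N by rewrite bin_gt0; lia.
have C2 : (0 < 'C(n, l + d.+1))%N by rewrite bin_gt0; lia.
rewrite -(@ltn_pmul2l ('C(n, k + d.+1) * 'C(n, l + d.+1))) ?muln_gt0 ?C1 //.
by have := ltn_mul IHd step; lia.
Qed.

(** * Shape and number of the zero entries *)

(* The zero pattern of the extremal matrix, with 0-based i and j: in the
   1-based notation t = i - d, it reads j < t or j = t + 1. *)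
Definition zero_entry (n d i j : nat) : bool :=
  [&& d <= i, d + j < n & (d + j < i) || (d + j == i.+1)]%N.

(** Since t may be zero or negative, it lives in [int]; [zero_entry] avoids the subtraction by
    adding d to j. *)
Lemma zero_entryP (n d : nat) (i j : 'I_n) :
  let t : int := i.+1%:Z - d%:Z in
  [/\ 1 <= t <= (n - d)%N%:Z, 1 <= j.+1%:Z <= (n - d)%N%:Z
    & (j.+1%:Z < t) \/ (j.+1%:Z = t + 1)] <-> zero_entry n d i j.
Proof.
by rewrite /zero_entry /=; have := ltn_ord i; split=> [[]|]; [|split]; lia.
Qed.

Lemma vert_ra_pointP (R : realType) (n d : nat) (b : nat -> nat) (i j : 'I_n) :
  (0 < d)%N -> (forall k, (k < n)%N -> (0 < b k)%N) ->
  (forall k l, (k < l)%N -> (d + l < n)%N ->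
    (b k * b (d + l) < b l * b (d + k))%N) ->
  vert (RA R (fun k : 'I_n => b k) d) (ra_point R (fun k : 'I_n => b k) d i.+1 j.+1)
  <-> ~~ zero_entry n d i j.
Proof.
move=> d_gt0 b_gt0 b_mono; split; last first.
  rewrite /zero_entry; have [lt_id _|le_di] := ltnP i d; first exact: vert_ra_point_le.
  have [lt_dj|le_ndj _] := ltnP (d + j) n; last exact: vert_ra_point_ge.
  have [|lt_dj'|e _] := ltngtP (d + j) i => //=; last exact: vert_ra_point_diag.
  by move=> ne; apply: vert_ra_point_above => //; lia.
apply: contraPN => /and3P[le_di lt_dj /orP[lt|/eqP e]].
  exact: not_vert_ra_point_below.
(* From d <= i and d + j = i + 1 it follows that j > 0. *)
by apply: not_vert_ra_point_succ => //; have := ltn_ord i; lia.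
Qed.

Lemma sum_ord_ltn (n k : nat) : (k <= n)%N -> (\sum_(j < n) (j < k) = k)%N.
Proof.
move=> le_kn; under eq_bigr => j _ do rewrite -[nat_of_bool _]/(if j < k then 1 else 0)%N.
by rewrite -big_mkcond -(big_ord_widen n (fun=> 1%N)) // sum1_card card_ord.
Qed.

Lemma card_zero_entry (n d : nat) : (0 < d < n)%N ->
  #|[set p : 'I_n * 'I_n | zero_entry n d p.1 p.2]%SET| =
  (((n - d - 1) * (n - d + 2)) %/ 2)%N.
Proof.
move=> /andP[d_gt0 lt_dn].
(* Row i >= d has the zeros j < i - d, and one more at j = i + 1 - d unless it is the last row. *)
have row i : (i < n)%N -> (\sum_(j < n) zero_entry n d i j)%N =
    (if d <= i then (i - d) + (i.+1 < n) else 0)%N.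
  move=> lt_in; rewrite /zero_entry; case: (leqP d i) => [le_di|_]; last by rewrite big1.
  rewrite -(@sum_ord_ltn n (i - d)); last by lia.
  have -> : nat_of_bool (i.+1 < n)%N = (\sum_(j < n) (d + j == i.+1) * (i.+1 < n))%N.
    case: ltnP => lt_i1; last by rewrite big1 // => j _; rewrite muln0.
    have lt_e : (i.+1 - d < n)%N by lia.
    rewrite (bigD1 (Ordinal lt_e)) //= subnKC; last by lia.
    rewrite eqxx big1 // => j; rewrite -val_eqE /= => ne.
    by rewrite (_ : (_ == _) = false) //; lia.
  rewrite -big_split; apply: eq_bigr => j _ /=.
  by lia.
have -> : #|[set p : 'I_n * 'I_n | zero_entry n d p.1 p.2]%SET| =
    (\sum_(i < n) if d <= i then (i - d) + (i.+1 < n) else 0)%N.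
  rewrite -sum1_card big_mkcond /=.
  under eq_bigr => p _ do rewrite inE -[if _ then _ else _]/(nat_of_bool _).
  rewrite -(pair_bigA _ (fun i j : 'I_n => nat_of_bool (zero_entry n d i j))) /=.
  by apply: eq_bigr => i _; rewrite row.
rewrite -(big_mkord xpredT (fun i => if d <= i then (i - d) + (i.+1 < n) else 0)%N).
rewrite (@big_cat_nat _ _ _ d) //= ?(ltnW lt_dn) // big1_seq ?add0n; last first.
  by move=> k /=; rewrite mem_index_iota => /andP[_ kd]; rewrite leqNgt kd.
rewrite -{1}[d]add0n big_addn.
have -> : (\sum_(0 <= s < n - d) (if d <= s + d then (s + d - d) + ((s + d).+1 < n)
    else 0) = \sum_(0 <= s < n - d) (s + (s.+1 < n - d)))%N.
  by apply: eq_big_nat => s _; rewrite leq_addl addnK; lia.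
(* With m = n - d, the two parts add up to m (m - 1) / 2 + (m - 1). *)
rewrite big_split /= bin2_sum big_mkord.
have -> : (\sum_(s < n - d) (s.+1 < n - d) = n - d - 1)%N.
  rewrite -[RHS](@sum_ord_ltn (n - d)); last by lia.
  by apply: eq_bigr => s _; lia.
rewrite bin2; case: (n - d)%N => // m.
rewrite subSS subn0 /= -divn2; nia.
Qed.

(** * From the matrix to the vertex set and its cardinality *)

Lemma card_eq_finset (T : finType) (A : {set T}) : ([set` A] #= `I_#|A|)%card.
Proof.
(* The enumeration by [nth] takes its default value from A, so the empty set is treated apart. *)
have [->|[x0 _]] := set_0Vmem A.
  by rewrite cards0 II0 (_ : [set` _] = set0) // -subset0 => x /=; rewrite inE.
have -> : [set` A] = nth x0 (enum A) @` `I_#|A|.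
  apply/seteqP; split=> [x|_ [k /= lt_k <-]] /=.
    rewrite -mem_enum => xA; exists (index x (enum A)); last exact: nth_index.
    by rewrite /= cardE index_mem.
  by rewrite -mem_enum mem_nth -?cardE.
apply: inj_card_eq => k l; rewrite !inE /= !cardE => lt_k lt_l /eqP.
by rewrite nth_uniq ?enum_uniq // => /eqP.
Qed.

Theorem theorem54 (R : realType) (n d : nat) :
  (2 <= n)%N -> (1 <= d <= n - 1)%N ->
  let m := (n - d)%N in
  let a := (fun k : 'I_n => 'C(n, k.+1)) in
  let M := extremal_matrix R a d in
  [/\ forall i j : 'I_n,
        let t : int := i.+1%:Z - d%:Z in
        let Z := [/\ 1 <= t <= m%:Z, 1 <= j.+1%:Z <= m%:Z
                   & (j.+1%:Z < t) \/ (j.+1%:Z = t + 1)] in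
        (M i j = 0%N <-> Z) /\ (~ Z -> M i j = 1%N),
      vert (RA R a d) =
        [set x | exists i j : 'I_n, M i j = 1%N /\ x = ra_point R a d i.+1 j.+1],
      forall i j i' j' : 'I_n, M i j = 1%N -> M i' j' = 1%N ->
        ra_point R a d i.+1 j.+1 = ra_point R a d i'.+1 j'.+1 ->
        i = i' /\ j = j'
    & (vert (RA R a d) #= `I_(n ^ 2 - ((m - 1) * (m + 2)) %/ 2)%N)%card ].
Proof.
move=> n_ge2 /andP[d_gt0 le_dn] m a M.
(* Extends [a] to all of [nat], so that shifted indices d + k can be written without ordinals. *)
pose b (k : nat) : nat := 'C(n, k.+1).
have b_gt0 k : (k < n)%N -> (0 < b k)%N by rewrite bin_gt0.
have b_mono k l : (k < l)%N -> (d + l < n)%N -> (b k * b (d + l) < b l * b (d + k))%N.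
  by move=> kl dl; rewrite /b -addnS -[(d + k).+1]addnS ![(d + _)%N]addnC bin_log_concave //; lia.
have ME i j : M i j = ~~ zero_entry n d i j.
  rewrite mxE; congr nat_of_bool; apply/asboolP/idP.
    by move/(vert_ra_pointP R i j d_gt0 b_gt0 b_mono).
  by move/(vert_ra_pointP R i j d_gt0 b_gt0 b_mono).
have M1 i j : M i j = 1%N -> vert (RA R a d) (ra_point R a d i.+1 j.+1).
  by rewrite mxE; case: asboolP.
have vertE : vert (RA R a d) =
    [set x | exists i j : 'I_n, M i j = 1%N /\ x = ra_point R a d i.+1 j.+1].
  apply/seteqP; split=> [x|_ [i [j [/M1 Mij ->]]]] //= vx.
  have : vert (RA R a d) x by [].
  (* A vertex is a sum of two generators, and its entry is then 1 by the definition of M. *)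
  rewrite {1}RA_conv_family => /vert_minkowski_sum_conv_family[i [j xE]].
  exists i, j; split=> //; rewrite mxE asboolT // /ra_point -xE //.
have inj (i j i' j' : 'I_n) : M i j = 1%N ->
    ra_point R a d i.+1 j.+1 = ra_point R a d i'.+1 j'.+1 -> i = i' /\ j = j'.
  by move=> /M1; exact: (@ra_point_inj R n d b).
split=> //.
- move=> i j t Z; have ZP : Z <-> zero_entry n d i j := zero_entryP d i j.
  rewrite ME; split; last by move=> nZ; rewrite (introN idP) // => /ZP.
  by rewrite ZP; case: zero_entry.
- by move=> i j i' j' /inj + _; apply.
pose Z := [set p : 'I_n * 'I_n | zero_entry n d p.1 p.2]%SET.
have -> : (n ^ 2 - ((m - 1) * (m + 2)) %/ 2)%N = #|~: Z|.
  rewrite -card_zero_entry -/Z; last by lia.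
  by have := cardsC Z; rewrite card_prod !card_ord mulnn; lia.
(* The vertex set is the image of the nonzero positions, and [inj] makes the map injective there. *)
have -> : vert (RA R a d) =
    (fun p : 'I_n * 'I_n => ra_point R a d p.1.+1 p.2.+1) @` [set` ~: Z].
  rewrite vertE; apply/seteqP; split=> [_ [i [j [Mij ->]]]|_ [[i j] /= ijZ <-]].
    exists (i, j) => //=; rewrite !inE /=.
    by move: Mij; rewrite ME; case: zero_entry.
  by exists i, j; split=> //; rewrite ME; move: ijZ; rewrite !inE /= => ->.
rewrite (card_eql (inj_card_eq _)) ?card_eq_finset //.
move=> [i j] [i' j']; rewrite !inE /= => + _ e; rewrite !inE /= => Zij.
by have [|-> ->] := inj i j i' j' _ e; rewrite ?ME ?Zij.
Qed.
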